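(* Fix integers $k\ge 3$ and $\ell\ge 1$. Let $C\le \mathbb{F}_2^{\ell}$ be a binary linear code. Then for $n=\ell(k-1)$ there exists a $[k,1]$-avoider $S\subseteq \mathbb{F}_2^n$ for which $|S|=2^n-W_C(1,\,2^{k-1}-1)$.
   Context: A $k$-flat of $\mathbb{F}_2^n$ is a $k$-dimensional affine subspace of $\mathbb{F}_2^n$. A set $S\subseteq \mathbb{F}_2^n$ is a $[k,t]$-avoider if there is no $k$-flat $F\subseteq\mathbb{F}_2^n$ with $|S\cap F|=t$. A binary linear code $C$ of length $\ell$ is a linear subspace of $\mathbb{F}_2^{\ell}$. The weight of a codeword is the number of its coordinates equal to $1$. The weight enumerator of $C$ is the polynomial $W_C(x,y)=\sum_{w=0}^{\ell}A_w x^w y^{\ell-w}$, where $A_w$ is the number of codewords of $C$ of weight $w$. *)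

(* Defs.v *)
From HB Require Import structures.
From mathcomp Require Import all_boot all_order all_algebra.
From mathcomp Require Import mpoly.

Set Implicit Arguments.
Unset Strict Implicit.
Unset Printing Implicit Defensive.

Import GRing.Theory.
Local Open Scope ring_scope.

Definition is_flat (n k : nat) (F : {set 'rV['F_2]_n}) : Prop :=
  exists (x : 'rV['F_2]_n) (V : {vspace 'rV['F_2]_n}),
    \dim V = k /\ F = [set x + v | v in V].

Definition avoider (n k t : nat) (S : {set 'rV['F_2]_n}) : Prop :=
  ~ exists F : {set 'rV['F_2]_n}, is_flat k F /\ #|S :&: F| = t.

Definition hweight (l : nat) (c : 'rV['F_2]_l) : nat :=
  #|[set i : 'I_l | c 0 i == 1]|.

Definition weight_count (l : nat) (C : {vspace 'rV['F_2]_l}) (w : nat) : nat :=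
  #|[set c : 'rV['F_2]_l | (c \in C) && (hweight c == w)]|.

(* The variables x and y are 'X_0 and 'X_1. *)
Definition weight_enum (l : nat) (C : {vspace 'rV['F_2]_l}) : {mpoly int[2]} :=
  \sum_(w < l.+1)
    (weight_count C w)%:R *: ('X_(0 : 'I_2) ^+ w * 'X_(1 : 'I_2) ^+ (l - w)).

Definition eval2 (p : {mpoly int[2]}) (a b : int) : int :=
  p.@[tnth [tuple a; b]].

(* Main.v *)
Require Import Defs.
From HB Require Import structures.
From mathcomp Require Import all_boot all_order all_algebra.
From mathcomp Require Import mpoly.

Set Implicit Arguments.
Unset Strict Implicit.
Unset Printing Implicit Defensive.

Import GRing.Theory.
Local Open Scope ring_scope.

(** Split the coordinates of [F_2^(l * m)], where [m = k - 1], into [l] blocks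
    of length [m], and let [zero_blocks x] be the vector of [F_2^l] recording
    which blocks of [x] vanish.  The avoider is the set of all [x] for which
    [zero_blocks x] lies outside [C].

    Each coordinate of [zero_blocks] is the indicator of a subspace of
    codimension [m < k].  Every [k]-flat has a nonzero direction in that
    subspace, and translation along it pairs off the points where the indicator
    is one, so the indicator sums to zero over the flat
    ([sum_zero_blocks_flat]).  If a flat met the avoider in a single point [p],
    then [zero_blocks p] would be the sum of the values of [zero_blocks] at the
    other points of the flat; these lie in [C], hence so would
    [zero_blocks p], a contradiction ([zero_blocks_avoider]).

    For the size, prescribing [zero_blocks x = c] leaves one choice for each
    block on the support of [c] and [2 ^ m - 1] choices for every other block,
    so the complement of the avoider has
    [\sum_(c in C) (2 ^ m - 1) ^ (l - hweight c)] points, which is the weight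
    enumerator evaluated at [(1, 2 ^ m - 1)]. *)

Definition zero_blocks (l m : nat) (x : 'rV['F_2]_(l * m)) : 'rV['F_2]_l :=
  \row_i (row i (vec_mx x) == 0)%:R.

Lemma addFF2 (a : 'F_2) : a + a = 0.
Proof. by rewrite -mulr2n -mulr_natr pchar_Fp_0 // mulr0. Qed.

Lemma F2_eq1 (a : 'F_2) : a = (a == 1)%:R.
Proof. by case: a => -[|[|//]] ha; apply: val_inj. Qed.

(** The translates [v] and [v + w] contribute equally and cancel in
    characteristic two; a coordinate where [w] is nonzero picks one vector from
    each such pair. *)
Lemma sum_translation_invariant (n : nat) (V : {vspace 'rV['F_2]_n})
    (w : 'rV['F_2]_n) (g : 'rV['F_2]_n -> 'F_2) :
  w \in V -> w != 0 -> (forall v, g (v + w) = g v) ->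
  \sum_(v in V) g v = 0.
Proof.
move=> wV /rV0Pn[j wj] gw.
have wj1 : w 0 j = 1 by rewrite (F2_eq1 (w 0 j)) in wj *; case: (_ == 1) wj.
rewrite (bigID (fun v : 'rV_n => v 0 j == 1)) /=.
rewrite [X in X + _](reindex_inj (addIr w)) /=.
rewrite (eq_big (fun v : 'rV_n => (v \in V) && (v 0 j != 1)) g).
- exact: addFF2.
- move=> v; rewrite rpredDr // mxE wj1; congr (_ && _).
  by case: (v 0 j) => -[|[|//]] ?.
- by move=> v _; rewrite gw.
Qed.

(** The map sending a vector to its [i]-th block has rank at most [m], so it
    kills a nonzero direction of a flat of dimension above [m]; the [i]-th
    coordinate of [zero_blocks] is invariant under translation by it. *)
Lemma sum_zero_blocks_flat (l m : nat) (x : 'rV['F_2]_(l * m))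
    (V : {vspace 'rV['F_2]_(l * m)}) :
  (m < \dim V)%N -> \sum_(v in V) zero_blocks (x + v) = 0.
Proof.
move=> ltmV; apply/rowP=> i; rewrite summxE mxE.
pose block : 'Hom('rV['F_2]_(l * m), 'rV['F_2]_m) :=
  linfun (row i \o vec_mx).
have V_ker : (V :&: lker block)%VS != 0%VS.
  rewrite -dimv_eq0 -lt0n.
  have := dimvS (subvf (block @: V)); rewrite dimvf /dim /= mul1n => le_m.
  rewrite -(ltn_add2r (\dim (block @: V))) add0n limg_ker_dim.
  exact: leq_ltn_trans le_m ltmV.
rewrite -vpick0 in V_ker.
have /memv_capP[wV] := memv_pick (V :&: lker block)%VS.
rewrite memv_ker lfunE /= => /eqP w0.
apply: (sum_translation_invariant wV V_ker) => v.
by rewrite !mxE addrA [in LHS]linearD [in LHS]linearD /= w0 addr0.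
Qed.

Lemma zero_blocks_avoider (l m k : nat) (C : {vspace 'rV['F_2]_l}) :
  (m < k)%N ->
  avoider k 1 [set x : 'rV['F_2]_(l * m) | zero_blocks x \notin C].
Proof.
move=> ltmk [F [[x [V [dimV ->]]] /eqP/cards1P[p Sp]]].
have : p \in [set p] by rewrite set11.
rewrite -Sp !inE => /andP[/negP pC /imsetP[v vV pE]]; apply: pC.
have /(sum_zero_blocks_flat x)/eqP : (m < \dim V)%N by rewrite dimV.
rewrite (bigD1 v) //= -pE addr_eq0 => /eqP->.
rewrite rpredN rpred_sum // => u /andP[uV]; apply: contraNT => uC.
have : x + u \in [set p] by rewrite -Sp !inE uC imset_f.
by rewrite inE pE => /eqP/addrI->.
Qed.

(** The blocks of [x] can be chosen independently, so the fiber is a product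
    over [i] of [{0}] when [c 0 i = 1] and of the nonzero vectors otherwise. *)
Lemma card_zero_blocks_fiber (l m : nat) (c : 'rV['F_2]_l) :
  #|[set x : 'rV['F_2]_(l * m) | zero_blocks x == c]|
    = ((2 ^ m).-1 ^ (l - hweight c))%N.
Proof.
pose glue (f : {ffun 'I_l -> 'rV['F_2]_m}) : 'rV['F_2]_(l * m) :=
  mxvec (\matrix_i f i).
have rowg f i : row i (vec_mx (glue f)) = f i by rewrite mxvecK rowK.
pose B i := [pred r : 'rV['F_2]_m | (r == 0) == (c 0 i == 1)].
have glue_inj : injective glue.
  by move=> f g eq_fg; apply/ffunP=> i; rewrite -!rowg eq_fg.
have -> : [set x | zero_blocks x == c] = [set glue f | f in family B].
  apply/setP=> x; rewrite inE; apply/eqP/imsetP => [zx | [f /familyP fB ->]].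
    exists [ffun i => row i (vec_mx x)].
      by apply/familyP=> i; rewrite ffunE inE -zx mxE; case: (_ == 0).
    apply: (can_inj vec_mxK); apply/row_matrixP=> i.
    by rewrite rowg ffunE.
  apply/rowP=> i; rewrite mxE rowg (F2_eq1 (c 0 i)).
  by have := fB i; rewrite inE => /eqP->.
rewrite card_imset // card_family foldrE big_image /=.
have cardB i : #|B i| = if c 0 i == 1 then 1%N else (2 ^ m).-1.
  case: ifP => ci.
    rewrite -[RHS](card1 (0 : 'rV['F_2]_m)).
    by apply: eq_card => r; rewrite !inE ci eqb_id.
  have <- : #|predC1 (0 : 'rV['F_2]_m)| = (2 ^ m).-1.
    by rewrite cardC1 card_mx card_Fp // mul1n.
  by apply: eq_card => r; rewrite !inE ci eqbF_neg.
rewrite (eq_bigr _ (fun i _ => cardB i)) (bigID (fun i => c 0 i == 1)) /=.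
rewrite big1 => [|i ->//]; rewrite mul1n.
rewrite (eq_bigr (fun=> (2 ^ m).-1)) => [|i /negPf->//].
rewrite prod_nat_const; congr (_ ^ _)%N.
rewrite -[X in (X - _)%N](card_ord l) -(cardC [set i | c 0 i == 1]) addKn.
by apply: eq_card => i; rewrite !inE.
Qed.

Lemma eval2_weight_enum (l : nat) (C : {vspace 'rV['F_2]_l}) (b : int) :
  eval2 (weight_enum C) 1 b = \sum_(c in C) b ^+ (l - hweight c).
Proof.
have hw_lt (c : 'rV['F_2]_l) : (hweight c < l.+1)%N.
  by rewrite ltnS -[X in (_ <= X)%N](card_ord l) max_card.
rewrite /eval2 /weight_enum raddf_sum /=.
rewrite (partition_big (fun c => Ordinal (hw_lt c)) xpredT) //=.
apply: eq_bigr => w _.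
rewrite mevalZ rmorphM !rmorphXn /= !mevalXU /= expr1n mul1r.
rewrite (eq_bigr (fun=> b ^+ (l - w))); last by move=> c /andP[_ /eqP <-].
rewrite sumr_const -[RHS]mulr_natl; congr (_%:R * _).
by apply: eq_card => c; rewrite !inE.
Qed.

Theorem theorem1p5 (k l : nat) (hk : (3 <= k)%N) (hl : (1 <= l)%N)
    (C : {vspace 'rV['F_2]_l}) :
  exists S : {set 'rV['F_2]_(l * (k - 1))},
    avoider k 1 S /\
    #|S|%:Z = 2 ^+ (l * (k - 1)) - eval2 (weight_enum C) 1 (2 ^+ (k - 1) - 1).
Proof.
exists [set x | zero_blocks x \notin C]; split.
  by apply: zero_blocks_avoider; rewrite subn1 prednK // (leq_trans _ hk).
move: (k - 1)%N => m.
(* Count the complement of [S], fibered by [zero_blocks] over [C]. *)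
set S := [set x | _]; apply/eqP; rewrite -subr_eq opprK eq_sym; apply/eqP.
have -> : (2 : int) ^+ (l * m) = #|{: 'rV['F_2]_(l * m)}|%:Z.
  by rewrite card_mx card_Fp // mul1n -natz natrX.
rewrite -(cardsC S) PoszD; congr (_ + _).
have -> : ~: S = [set x | zero_blocks x \in C].
  by apply/setP=> x; rewrite !inE negbK.
rewrite -sum1_card (partition_big (@zero_blocks l m) (mem C)) /=; last first.
  by move=> x; rewrite inE.
rewrite eval2_weight_enum -natz natr_sum; apply: eq_bigr => c cC.
have -> : (2 : int) ^+ m - 1 = ((2 ^ m).-1)%:R.
  by rewrite [RHS]natz predn_int ?expn_gt0 // -natz natrX.
rewrite -natrX -card_zero_blocks_fiber -sum1_card; congr (_%:R).
by apply: eq_bigl => x; rewrite !inE; case: eqP => [->|]; rewrite ?cC ?andbF.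
Qed.
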